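(* Let $n\ge 1$ be an integer and let $0\le k\le n$. For the simple symmetric random walk of length $2n$ starting at the origin, let $p_{2k,2n}$ be the probability that in the time interval from $0$ to $2n$ the walk spends exactly $2k$ time units on the positive side and $2n-2k$ time units on the negative side. Then $$p_{2k,2n}=u_{2k}\cdot u_{2n-2k},\qquad\text{where } u_{2m}=\frac{1}{2^{2m}}\binom{2m}{m}\ \ (m\ge 0).$$
   Context: The simple symmetric random walk is $S_0=0$, $S_j=X_1+\dots+X_j$, where $X_1,\dots,X_{2n}$ are independent with $\mathcal P(X_i=1)=\mathcal P(X_i=-1)=\tfrac12$; equivalently, each of the $2^{2n}$ paths $(S_1,\dots,S_{2n})$ with $S_j-S_{j-1}=\pm1$ has probability $2^{-2n}$. The walk is said to spend the time unit from $j-1$ to $j$ on the positive side if at least one of $S_{j-1}$, $S_j$ is positive; otherwise it spends that time unit on the negative side. *)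

(* Defs.v *)
From mathcomp Require Import all_boot all_order all_algebra.
From mathcomp Require Import all_classical all_reals all_analysis.

Set Implicit Arguments.
Unset Strict Implicit.
Unset Printing Implicit Defensive.

Import Order.TTheory GRing.Theory Num.Theory.

Local Open Scope classical_set_scope.
Local Open Scope ring_scope.

Definition mutually_independent (d : measure_display) (T : measurableType d)
    (R : realType) (P : probability T R) (N : nat)
    (X : 'I_N -> {RV P >-> R}) : Prop :=
  forall (J : {set 'I_N}) (B : 'I_N -> set R),
    (forall i, measurable (B i)) ->
    P [set w | forall i, i \in J -> B i (X i w)] =
    (\prod_(i in J) P (X i @^-1` B i))%E.

(* The variables are numbered from 0: [X i] is the step from time [i] to time
   [i.+1], usually written X_(i+1). *)
Definition simple_symmetric_steps (d : measure_display) (T : measurableType d)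
    (R : realType) (P : probability T R) (N : nat)
    (X : 'I_N -> {RV P >-> R}) : Prop :=
  mutually_independent X /\
  (forall i, P [set w | X i w = 1] = (2^-1)%:E /\
             P [set w | X i w = -1] = (2^-1)%:E).

Definition walk (R : realType) (T : Type) (N : nat) (X : 'I_N -> T -> R)
    (j : nat) (w : T) : R :=
  \sum_(i < N | (i < j)%N) X i w.

(* [j : 'I_N] stands for the time unit from [j] to [j.+1]. *)
Definition on_positive_side (R : realType) (T : Type) (N : nat)
    (X : 'I_N -> T -> R) (w : T) (j : 'I_N) : bool :=
  (0 < walk X j w) || (0 < walk X j.+1 w).

Definition positive_time (R : realType) (T : Type) (N : nat)
    (X : 'I_N -> T -> R) (w : T) : nat :=
  #|[set j : 'I_N | on_positive_side X w j]%SET|.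

Definition negative_time (R : realType) (T : Type) (N : nat)
    (X : 'I_N -> T -> R) (w : T) : nat :=
  #|[set j : 'I_N | ~~ on_positive_side X w j]%SET|.

(* [u R m] is u_(2m). *)
Definition u (R : realType) (m : nat) : R :=
  1 / 2 ^+ (2 * m) * 'C(2 * m, m)%:R.

(* Main.v *)
Require Import Defs.
From mathcomp Require Import all_boot all_order all_algebra.
From mathcomp Require Import zify ring.
From mathcomp Require Import all_classical all_reals all_analysis.

(** Allow an arbitrary even starting height 2i >= 0 and count the paths with 2p
    positive and 2q negative time units.  There is a closed form: for q > 0 it is
    C(2p, p + i) C(2q, q), and for q = 0 it is the number of nonnegative paths.
    Splitting off the first two steps, it follows by induction on p + q from
    Pascal's rule; at height 0 the negative side is handled by the symmetry
    h -> -h, which exchanges positive and negative units.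

    The steps are +1 or -1 only almost surely, so the probability is computed by
    conditioning on successive steps: given that the first j steps form a
    prescribed sign pattern, the remaining positive time is distributed as in the
    counting problem started from the height reached. *)

Set Implicit Arguments.
Unset Strict Implicit.
Unset Printing Implicit Defensive.
Import Order.TTheory GRing.Theory Num.Theory.
Local Open Scope classical_set_scope.
Local Open Scope ring_scope.

(** * Counting paths by their positive time *)

Definition positive_unit (h h' : int) : bool := (0 < h) || (0 < h').

(* The number of paths with N steps +1 or -1, starting at height h, that spend
   exactly a time units on the positive side. *)
Fixpoint npaths (N : nat) (h : int) (a : nat) : nat :=
  if N is N'.+1 then
    let from h' := if (positive_unit h h' <= a)%N
                   then npaths N' h' (a - positive_unit h h')%N else 0%N in
    (from (h + 1)%R + from (h - 1)%R)%N
  else (a == 0)%N.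

Lemma npathsS N h a : npaths N.+1 h a =
  ((if (positive_unit h (h + 1) <= a)%N
    then npaths N (h + 1) (a - positive_unit h (h + 1)) else 0) +
   (if (positive_unit h (h - 1) <= a)%N
    then npaths N (h - 1) (a - positive_unit h (h - 1)) else 0))%N.
Proof. by []. Qed.

Lemma npaths_gt N h a : (N < a)%N -> npaths N h a = 0%N.
Proof.
elim: N h a => [|N IH] h a; first by case: a.
move=> ltNa; rewrite npathsS !IH ?if_same //.
  by case: positive_unit; lia.
by case: positive_unit; lia.
Qed.

Lemma npaths_pos N h a : 0 < h ->
  npaths N.+1 h a.+1 = (npaths N (h + 1) a + npaths N (h - 1) a)%N.
Proof. by move=> h0; rewrite npathsS /positive_unit h0 /= subn1. Qed.

Lemma npaths_pos2 N h a : 1 < h -> npaths N.+2 h a.+2 =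
  (npaths N (h + 2) a + 2 * npaths N h a + npaths N (h - 2) a)%N.
Proof.
move=> h1; rewrite !npaths_pos; try lia.
rewrite addrK subrK -(addrA h 1 1) -(addrA h (-1) (-1)) -opprD.
by rewrite mul2n -addnn !addnA.
Qed.

Lemma npaths_pos0 N h : 0 < h -> npaths N.+1 h 0 = 0%N.
Proof. by move=> h0; rewrite npathsS /positive_unit h0. Qed.

Lemma npaths_neg N h a : h < 0 ->
  npaths N.+1 h a = (npaths N (h + 1) a + npaths N (h - 1) a)%N.
Proof.
move=> h0; rewrite npathsS /positive_unit.
have -> : (0 < h) = false by lia.
have -> : (0 < h + 1) = false by lia.
have -> : (0 < h - 1) = false by lia.
by rewrite /= subn0.
Qed.

Lemma npaths_zero N a : npaths N.+1 0 a =
  ((if 0 < a then npaths N 1 a.-1 else 0) + npaths N (-1) a)%N.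
Proof. by rewrite npathsS /positive_unit /= add0r sub0r subn0 subn1. Qed.

(** Neighbouring heights never have opposite signs and are never both 0, so reflecting a path in the
    axis turns each positive unit into a negative one and conversely. *)
Lemma npaths_opp N h a : (a <= N)%N -> npaths N (- h) a = npaths N h (N - a).
Proof.
elim: N h a => [|N IH] h a leaN.
  by move: leaN; rewrite leqn0 => /eqP->.
have pos h' a' : 0 < h' -> (a' <= N.+1)%N ->
    npaths N.+1 (- h') a' = npaths N.+1 h' (N.+1 - a').
  move=> h'0; rewrite leq_eqVlt => /predU1P[->|].
    rewrite subnn npaths_pos0// npaths_neg; last by lia.
    by rewrite !npaths_gt.
  rewrite ltnS => lea'N.
  rewrite subSn// npaths_pos// npaths_neg; last by lia.
  have -> : - h' + 1 = - (h' - 1) by lia.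
  have -> : - h' - 1 = - (h' + 1) by lia.
  by rewrite !IH// addnC.
have [h0|h0|h0] := ltrgtP 0 h; last subst h.
- exact: pos.
- have := @pos (- h) (N.+1 - a)%N; rewrite opprK => ->; [|lia|lia].
  by congr npaths; lia.
- rewrite oppr0 !npaths_zero.
  have e h' a' : (a' <= N)%N -> npaths N h' a' = npaths N (- h') (N - a').
    by move=> le; rewrite -IH ?opprK.
  (* The extreme values 0 and [N.+1] are treated apart: there one of the two first steps contributes
     no path. *)
  case: a leaN => [|a] leaN /=.
    by rewrite subn0 /= (npaths_gt _ (ltnSn N)) addn0 add0n IH// subn0.
  rewrite subSS e//.
  have [eqa|lta] := eqVneq a N.
    by rewrite eqa subnn /= (npaths_gt _ (ltnSn N)) addn0.
  have -> : (0 < N - a)%N by lia.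
  have ltaN : (a < N)%N by rewrite ltn_neqAle lta -ltnS.
  rewrite addnC (IH 1 a.+1)//.
  by congr (npaths _ _ _ + npaths _ _ _)%N; lia.
Qed.

(** * The closed form from even heights *)

Definition cbin (p i : nat) : nat := 'C(2 * p, p + i).

Lemma cbinS p i :
  cbin p.+1 i.+1 = (cbin p i.+2 + 2 * cbin p i.+1 + cbin p i)%N.
Proof.
rewrite /cbin mulnS add2n (_ : p.+1 + i.+1 = (p + i).+2)%N; last by lia.
by rewrite !binS !addnS; lia.
Qed.

Lemma cbinS0 p : cbin p.+1 0 = (2 * cbin p 1 + 2 * cbin p 0)%N.
Proof.
case: p => [//|p]; rewrite /cbin !addn0 mulnS add2n binS.
(* The two middle entries of an odd row agree, so both Pascal summands are equal. *)
have sym : 'C((2 * p.+1).+1, p.+1) = 'C((2 * p.+1).+1, p.+2).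
  by rewrite -bin_sub; [congr 'C(_, _)|]; lia.
by rewrite sym binS addn1; lia.
Qed.

Lemma cbin00 : cbin 0 0 = 1%N.
Proof. by []. Qed.

Lemma cbin0S i : cbin 0 i.+1 = 0%N.
Proof. by []. Qed.

(* By reflection this counts the paths of length 2p from height 2i that stay
   nonnegative; 'C(2p, p + j) and 'C(2p, p - j) are merged into one term. *)
Definition bin_window (p i : nat) : nat :=
  (cbin p 0 + \sum_(j < i) 2 * cbin p j.+1)%N.

(** A nonnegative path from 0 must start upwards, which leaves two of the four pairs of first
    steps. *)
Lemma bin_windowS0 p :
  bin_window p.+1 0 = (bin_window p 1 + bin_window p 0)%N.
Proof. by rewrite /bin_window big_ord1 !big_ord0 cbinS0 /=; lia. Qed.

Lemma bin_windowS p i : bin_window p.+1 i.+1 =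
  (bin_window p i.+2 + 2 * bin_window p i.+1 + bin_window p i)%N.
Proof.
have E q j : bin_window q j.+1 = (bin_window q j + 2 * cbin q j.+1)%N.
  by rewrite /bin_window big_ord_recr addnA.
have E0 q : bin_window q 0 = cbin q 0 by rewrite /bin_window big_ord0 addn0.
elim: i => [|i IH]; first by rewrite !E bin_windowS0 !E cbinS !E0; lia.
by rewrite E IH cbinS !E; lia.
Qed.

Lemma bin_window0 i : bin_window 0 i = 1%N.
Proof. by rewrite /bin_window big1. Qed.

(* From height 2i, with 2p positive and 2q negative units. For q > 0 the path
   must visit 0, and then the count is a product; its first factor is the number
   of unrestricted paths of length 2p from 2i to 0. *)
Definition npaths2 (p q i : nat) : nat :=
  if q is 0 then bin_window p i else (cbin p i * cbin q 0)%N.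

Lemma npaths2_0 p q : npaths2 p q 0 = (cbin p 0 * cbin q 0)%N.
Proof. by case: q => //=; rewrite /bin_window big_ord0 muln1 addn0. Qed.

Lemma npaths2_posS p q i : npaths2 p.+1 q i.+1 =
  (npaths2 p q i.+2 + 2 * npaths2 p q i.+1 + npaths2 p q i)%N.
Proof. by case: q => [|q] /=; rewrite ?bin_windowS// cbinS; lia. Qed.

Lemma npaths_even (m p q i : nat) : (p + q = m)%N ->
  npaths (2 * m) (2 * i)%N%:Z (2 * p) = npaths2 p q i.
Proof.
elim: m p q i => [|m IH] p q i.
  by case: p q => [|//] [|//] _ /=; rewrite bin_window0.
case: i => [|i] pq; rewrite mulnS.
- rewrite npaths2_0.
  have up p' : (p = p'.+1)%N ->
      (npaths (2 * m).+1 1 (2 * p).-1 = npaths2 p' q 1 + npaths2 p' q 0)%N.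
    move=> pE; rewrite pE mulnS add2n npaths_pos// -!IH//; lia.
  (* Reflection moves the start from -1 to 1 and exchanges the roles of [p] and [q]. *)
  have down q' : (q = q'.+1)%N ->
      (npaths (2 * m).+1 (-1) (2 * p) = npaths2 q' p 1 + npaths2 q' p 0)%N.
    move=> qE; rewrite npaths_opp; last by lia.
    have -> : ((2 * m).+1 - 2 * p = (2 * q').+1)%N by lia.
    rewrite npaths_pos// -!IH//; lia.
  rewrite muln0 npaths_zero.
  case: p pq up down => [|p] pq up down.
    rewrite add0n in pq; subst q.
    rewrite (down m)// npaths2_0 /npaths2 /bin_window big_ord1 cbinS0 cbin00 /=.
    by lia.
  rewrite (up p)//; case: q pq up down => [|q] pq up down.
    (* After a step down, fewer units remain than must be positive. *)
    rewrite (npaths_gt _ (_ : _ < 2 * p.+1)%N); last by lia.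
    by rewrite !npaths2_0 /npaths2 /bin_window big_ord1 cbinS0 cbin00 /=; lia.
  (* By [cbinS0], each of the two first steps accounts for half of the product. *)
  by rewrite (down q)//= !cbinS0; lia.
- case: p pq => [|p] pq.
    rewrite npaths_pos0; last by lia.
    by case: q pq => //= q _; rewrite cbin0S.
  have pqm : (p + q = m)%N by lia.
  rewrite npaths2_posS (mulnS 2 p) !add2n npaths_pos2; last by lia.
  rewrite -!(IH p q)//.
  by congr (npaths _ _ _ + _ + npaths _ _ _)%N; lia.
Qed.

Lemma npaths_origin n k : (k <= n)%N ->
  npaths (2 * n) 0 (2 * k) = ('C(2 * k, k) * 'C(2 * (n - k), n - k))%N.
Proof.
by move=> lekn; rewrite (@npaths_even n k (n - k) 0) ?subnKC// npaths2_0 /cbin !addn0.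
Qed.

(** * From probabilities to path counts *)

Section PositiveTime.
Context (d : measure_display) (T : measurableType d)
    (R : realType) (P : probability T R) (N : nat)
    (X : 'I_N -> {RV P >-> R}).

Lemma walk_succ (j : 'I_N) w : walk X j.+1 w = walk X j w + X j w.
Proof.
rewrite /walk (bigD1 j)//= addrC; congr (_ + _).
by apply: eq_bigl => i; rewrite ltnS ltn_neqAle andbC.
Qed.

Definition positive_from (j : nat) (w : T) : nat :=
  (\sum_(i < N | (j <= i)%N) on_positive_side X w i)%N.

Lemma positive_from_succ (j : 'I_N) w :
  positive_from j w = (on_positive_side X w j + positive_from j.+1 w)%N.
Proof.
rewrite /positive_from (bigD1 j)//=; congr (_ + _)%N.
by apply: eq_bigl => i; rewrite [RHS]ltn_neqAle eq_sym andbC.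
Qed.

Lemma measurable_walk j : measurable_fun setT (walk X j : T -> R).
Proof.
rewrite (_ : walk X j = fun w => \sum_(i < N) if (i < j)%N then X i w else 0).
  apply: measurable_sum => i; have [_|_] := boolP (_ <= _)%N; first exact: measurable_funPT.
  exact: measurable_cst.
by apply/funext => w; rewrite /walk big_mkcond.
Qed.

Lemma measurable_positive_from j a : measurable [set w | positive_from j w = a].
Proof.
have mf : measurable_fun setT (fun w => (positive_from j w)%:R : R).
  rewrite (_ : (fun w => _) = fun w => \sum_(i < N)
      (if (j <= i)%N then (on_positive_side X w i)%:R else 0)); last first.
    by apply/funext => w; rewrite /positive_from natr_sum big_mkcond.
  apply: measurable_sum => i; have [_|_] := boolP (_ <= _)%N; last exact: measurable_cst.
  apply: (measurableT_comp (f := fun b : bool => b%:R : R)) => //.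
  apply: measurable_or; apply: measurable_realfun.measurable_fun_ltr;
    solve [exact: measurable_cst | exact: measurable_walk].
have -> : [set w | positive_from j w = a] = (fun w => (positive_from j w)%:R : R) @^-1` [set a%:R].
  apply/seteqP; split => w /=; first by move=> ->.
  by move/eqP; rewrite eqr_nat => /eqP.
by rewrite -[X in measurable X]setTI; apply: mf.
Qed.

Definition step (b : bool) : int := if b then 1 else -1.

Definition prefix_event (s : seq bool) : set T :=
  [set w | forall i : 'I_N, (i < size s)%N -> X i w = (step (nth false s i))%:~R].

Lemma measurable_step (j : 'I_N) (x : R) : measurable [set w | X j w = x].
Proof. exact: (measurable_funPTI (X j) (measurable_set1 x)). Qed.

Lemma measurable_prefix_event s : measurable (prefix_event s).
Proof.
have -> : prefix_event s = \bigcap_(i in [set i : 'I_N | (i < size s)%N])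
    [set w | X i w = (step (nth false s i))%:~R] by [].
apply: fin_bigcap_measurable => //.
by move=> i _; exact: measurable_step.
Qed.

Context (sX : simple_symmetric_steps X).

Lemma prefix_eventS s b (j : 'I_N) : size s = j ->
  prefix_event (rcons s b) = prefix_event s `&` [set w | X j w = (step b)%:~R].
Proof.
move=> sj; apply/seteqP; split => w /=; rewrite /prefix_event /=.
  move=> H; split => [i lti|].
    by rewrite H ?size_rcons ?ltnS ?(ltnW lti)// nth_rcons lti.
  by rewrite H ?size_rcons -sj// nth_rcons ltnn eqxx.
move=> [H1 H2] i; rewrite size_rcons ltnS leq_eqVlt nth_rcons => /predU1P[e|lti].
  by rewrite e ltnn eqxx -H2; congr (X _ w); apply/val_inj; rewrite /= e.
by rewrite lti H1.
Qed.

(** The two values of the step are disjoint events with probabilities adding up to 1, so what they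
    leave out of [A] is null. *)
Lemma prob_split (j : 'I_N) (A : set T) : measurable A ->
  P A = (P (A `&` [set w | X j w = 1%R]) + P (A `&` [set w | X j w = (-1)%R]))%E.
Proof.
move=> mA; have mj x := measurable_step j x.
have dis B : (B `&` [set w | X j w = 1]) `&` (B `&` [set w | X j w = -1]) = set0.
  apply/seteqP; split => // w [[_ /= ->] [_ /= /eqP]].
  by rewrite gt_eqF// (lt_trans (ltrN10 R)).
set U := [set w | X j w = 1] `|` [set w | X j w = -1].
have mU : measurable U by exact: measurableU.
have PU : P (~` U) = 0%E.
  rewrite probability_setC// measureU//; last by have := dis setT; rewrite !setTI.
  have [_ /(_ j)[H1 H2]] := sX.
  transitivity (1 - ((2^-1)%:E + (2^-1)%:E) : \bar R)%E.
    by congr (1 - (_ + _))%E; [exact: H1|exact: H2].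
  have half2 : 2^-1 + 2^-1 = 1 :> R by field.
  by rewrite -EFinD half2; exact: (@subee _ 1%:E).
rewrite -measureU; try exact: measurableI; last exact: dis.
rewrite -setIUr (measureDI _ mA mU) [X in (X + _)%E](_ : _ = 0%E) ?add0e//.
apply/eqP; rewrite -measure_le0 -PU le_measure ?inE//.
- exact: measurableD.
- exact: measurableC.
Qed.

(** Independence enters here, applied to all the steps at once. *)
Lemma prob_prefix_full s : size s = N -> P (prefix_event s) = ((2 ^+ N)^-1)%:E.
Proof.
move=> sN; have [ind uni] := sX.
have := ind [set: 'I_N]%SET (fun i => [set (step (nth false s i))%:~R]) (fun i => measurable_set1 _).
have -> : [set w | forall i, i \in [set: 'I_N]%SET -> [set ((step (nth false s i))%:~R : R)] (X i w)]
    = prefix_event s.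
  apply/seteqP; split => w H i; first by move=> _; apply: H; rewrite inE.
  by move=> _; apply: H; rewrite sN.
move=> ->; rewrite (eq_bigr (fun=> (2^-1)%:E)).
  by rewrite prodEFin prodr_const cardsT card_ord exprVn.
move=> i _; have [H1 H2] := uni i.
by rewrite /step; case: nth; [exact: H1|exact: H2].
Qed.

(** Joint probabilities replace conditional ones, so the denominator stays [2 ^+ N] throughout. The
    induction runs backwards from complete sign patterns, splitting on the next step. *)
Lemma prob_prefix_positive_from m s h a : (size s + m)%N = N ->
  (forall w, prefix_event s w -> walk X (size s) w = h%:~R) ->
  P (prefix_event s `&` [set w | positive_from (size s) w = a]) =
  ((npaths m h a)%:R / 2 ^+ N)%:E.
Proof.
elim: m s h a => [|m IH] s h a.
  rewrite addn0 => sN _.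
  have p0 w : positive_from (size s) w = 0%N.
    by rewrite /positive_from big_pred0// => i; rewrite sN leqNgt ltn_ord.
  have -> : [set w | positive_from (size s) w = a] = if a == 0%N then setT else set0.
    by apply/seteqP; split => w /=; rewrite p0; case: a.
  case: a => [|a] /=; first by rewrite setIT prob_prefix_full// mul1r.
  by rewrite setI0 measure0 mul0r.
move=> sN wh; have ltsN : (size s < N)%N by rewrite -sN -[X in (X < _)%N]addn0 ltn_add2l.
pose j := Ordinal ltsN.
have mA : measurable (prefix_event s `&` [set w | positive_from (size s) w = a]).
  by apply: measurableI; [exact: measurable_prefix_event|exact: measurable_positive_from].
have next b (h' := h + step b) : P (prefix_event s `&`
      [set w | positive_from (size s) w = a] `&` [set w | X j w = (step b)%:~R]) =
    ((if (positive_unit h h' <= a)%N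
      then npaths m h' (a - positive_unit h h') else 0%N)%:R / 2 ^+ N)%:E.
  have wh' w : prefix_event (rcons s b) w -> walk X (size s).+1 w = h'%:~R.
    rewrite (@prefix_eventS _ _ j)// => -[ws wj].
    by rewrite (walk_succ j) wh// wj -intrD.
  (* The extended prefix fixes both end heights of the next unit, hence its side. *)
  have pu w : prefix_event (rcons s b) w -> on_positive_side X w j = positive_unit h h'.
    move=> ws; rewrite /on_positive_side wh' // wh ?ltr0z//.
    by move: ws; rewrite (@prefix_eventS _ _ j)// => -[].
  rewrite setIAC -(@prefix_eventS _ _ j)//.
  case: ifPn => [le|gt].
    rewrite -(IH (rcons s b) h'); last 2 first.
    - by rewrite size_rcons addSnnS.
    - by move=> w; rewrite size_rcons; exact: wh'.
    congr (P _); apply/seteqP; split => w [ws /= e]; split => //=.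
      by rewrite -e size_rcons (positive_from_succ j) pu// addKn.
    by rewrite (positive_from_succ j) pu//= -[(size s).+1](size_rcons s b) e subnKC.
  (* Here the next unit is positive although [a] is 0, so the event is empty. *)
  rewrite mul0r (_ : _ `&` _ = set0) ?measure0//.
  apply/seteqP; split => // w [ws /=]; rewrite (positive_from_succ j) pu// => e.
  by move: gt; rewrite -e leq_addr.
by rewrite (prob_split j mA) (next true) (next false) -EFinD -mulrDl -natrD.
Qed.

Lemma positive_timeE w : positive_time X w = positive_from 0 w.
Proof. by rewrite /positive_time /positive_from cardsE -sum1_card big_mkcond. Qed.

Lemma negative_timeE w : negative_time X w = (N - positive_time X w)%N.
Proof.
have := cardsC [set j : 'I_N | on_positive_side X w j]%SET.
rewrite card_ord => /(canRL (addKn _)); rewrite -/(positive_time X w) => <-.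
by apply: eq_card => j; rewrite !inE.
Qed.

Lemma prob_positive_time a :
  P [set w | positive_time X w = a] = ((npaths N 0 a)%:R / 2 ^+ N)%:E.
Proof.
rewrite -(@prob_prefix_positive_from N [::] 0 a)//; last first.
  by move=> w _; rewrite /walk big_pred0.
congr (P _); apply/seteqP; split => w /=; rewrite positive_timeE; last by case.
by move=> <-; split.
Qed.

End PositiveTime.

Theorem proposition3p2 (d : measure_display) (T : measurableType d)
    (R : realType) (P : probability T R) (n k : nat)
    (X : 'I_(2 * n) -> {RV P >-> R}) :
  (1 <= n)%N -> (k <= n)%N ->
  simple_symmetric_steps X ->
  P [set w | positive_time X w = (2 * k)%N /\
             negative_time X w = (2 * n - 2 * k)%N]
  = (u R k * u R (n - k))%:E.
Proof.
move=> _ lekn sX.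
(* The two times add up to [2 * n], so the positive time determines the negative one. *)
have -> : [set w | positive_time X w = (2 * k)%N /\
    negative_time X w = (2 * n - 2 * k)%N] = [set w | positive_time X w = (2 * k)%N].
  by apply/seteqP; split => w /= [] // e; rewrite negative_timeE e.
rewrite prob_positive_time// npaths_origin// /u natrM !div1r; congr EFin.
have -> : (2 * n = 2 * k + 2 * (n - k))%N by rewrite -mulnDr subnKC.
by rewrite exprD; field; rewrite !expf_neq0// pnatr_eq0.
Qed.
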